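(* Under the isomorphism $F_2 \to \mathrm{Inn}\,F_2 = \mathrm{IA}_2$, $g\mapsto \iota_g$, where $x^{\iota_g}=g^{-1}xg$ for $x \in F_2$, the second derived subgroup $[[F_2,F_2],[F_2,F_2]]$ of $F_2$ corresponds to $\mathcal{K}_2$; that is, $$\mathcal{K}_2=\{\iota_g \mid g\in[[F_2,F_2],[F_2,F_2]]\}.$$
   Context: $F_2$ is the free group of rank $2$ with basis $x_1,x_2$, and $H:=F_2^{\mathrm{ab}}$ is its abelianization. $\mathrm{Aut}\,F_2$ acts on $F_2$ from the right: $x^\sigma$ is the image of $x$ under $\sigma$, and $x^{\sigma\tau}=(x^\sigma)^\tau$. $\mathrm{IA}_2$ is the kernel of the natural homomorphism $\mathrm{Aut}\,F_2\to\mathrm{Aut}\,H$; by a theorem of Nielsen it equals the inner automorphism group $\mathrm{Inn}\,F_2$, which is isomorphic to $F_2$ via $g \mapsto \iota_g$. For $i=1,2$ the Fox derivation $\frac{\partial}{\partial x_i}:\mathbf{Z}[F_2]\to\mathbf{Z}[F_2]$ is the additive map defined on a reduced word $w=x_{\mu_1}^{\epsilon_1}\cdots x_{\mu_r}^{\epsilon_r}$ ($\epsilon_j=\pm1$) by $\frac{\partial w}{\partial x_i}=\sum_{j=1}^{r}\epsilon_j\,\delta_{\mu_j,i}\,x_{\mu_1}^{\epsilon_1}\cdots x_{\mu_{j-1}}^{\epsilon_{j-1}}x_{\mu_j}^{\frac12(\epsilon_j-1)}$. Let $\mathfrak{a}:\mathbf{Z}[F_2]\to\mathbf{Z}[H]$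 be the ring homomorphism induced by abelianization. The Magnus representation is the homomorphism $r_M:\mathrm{IA}_2\to\mathrm{GL}(2,\mathbf{Z}[H])$, $\sigma\mapsto\left(\mathfrak{a}\left(\frac{\partial (x_i^{\sigma})}{\partial x_j}\right)\right)_{i,j}$; $\mathcal{K}_2$ denotes its kernel. *)

(* Defs.v *)
From HB Require Import structures.
From mathcomp Require Import ssreflect ssrfun ssrbool eqtype ssrnat seq choice.
From mathcomp Require Import path fintype tuple bigop generic_quotient.
From mathcomp Require Import ssralg ssrint matrix finmap monalg monoid.
From mathcomp Require Import boolp classical_sets.

Set Implicit Arguments.
Unset Strict Implicit.
Unset Printing Implicit Defensive.

Import GRing.Theory.

Local Open Scope classical_set_scope.
Local Open Scope quotient_scope.
Local Open Scope group_scope.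

Section Commutator.
Variable G : groupType.

Definition is_subgroup (A : set G) : Prop :=
  [/\ A 1, forall x y, A x -> A y -> A (x * y) & forall x, A x -> A x^-1].

Definition comm_subgroup (A B : set G) : set G :=
  smallest is_subgroup [set [~ a, b] | a in A & b in B].

Definition derived_subgroup : set G := comm_subgroup setT setT.

Definition second_derived_subgroup : set G :=
  comm_subgroup derived_subgroup derived_subgroup.

Lemma comm_subgroupP A B : is_subgroup (comm_subgroup A B).
Proof.
split=> [|x y hx hy|x hx] C [sgC sC]; have [C1 CM CV] := sgC => //.
- by apply: CM; [apply: (hx C)|apply: (hy C)].
- by apply: CV; apply: (hx C).
Qed.

Lemma derived_commg (x y : G) : derived_subgroup [~ x, y].
Proof. by apply: sub_gen_smallest; exists x => //; exists y. Qed.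

Lemma derived_conjg (x y : G) : derived_subgroup x -> derived_subgroup (x ^ y).
Proof.
have [_ dM _] := comm_subgroupP setT setT; rewrite -/derived_subgroup in dM.
move=> dx; suff -> : x ^ y = x * [~ x, y] by apply: dM => //; exact: derived_commg.
by rewrite /commg !mulgA mulgV mul1g /conjg mulgA.
Qed.

End Commutator.

Arguments derived_subgroup G : clear implicits.
Arguments second_derived_subgroup G : clear implicits.

Section Abelianization.
Variable G : groupType.

Definition ab_rel (x y : G) : bool := `[< derived_subgroup _ (x^-1 * y) >].

Lemma ab_rel_equiv : equiv_class_of ab_rel.
Proof.
have [d1 dM dV] := comm_subgroupP (@setT G) setT.
rewrite -/(derived_subgroup G) in d1 dM dV.
split=> [x|x y|y x z].
- by apply/asboolP; rewrite mulVg.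
- by apply/asboolP/asboolP => /dV; rewrite invgM invgK.
- move=> /asboolP xy /asboolP yz; apply/asboolP.
  by have := dM _ _ xy yz; rewrite mulgA mulgK.
Qed.

Canonical ab_equiv := EquivRelPack ab_rel_equiv.
Canonical ab_encModRel := defaultEncModRel ab_rel.

Definition abelianization : Type := {eq_quot ab_rel}.
HB.instance Definition _ := Choice.on abelianization.
HB.instance Definition _ : EqQuotient G ab_rel abelianization :=
  EqQuotient.on abelianization.

Definition abmap : G -> abelianization := \pi_abelianization.

Lemma abmapP x y : abmap x = abmap y <-> derived_subgroup _ (x^-1 * y).
Proof.
by split=> [/eqquotP/asboolP|h]; last by apply/eqquotP/asboolP.
Qed.

Lemma abmap_repr (c : abelianization) : abmap (repr c) = c.
Proof. exact: reprK. Qed.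

Lemma repr_abmap x : derived_subgroup _ ((repr (abmap x))^-1 * x).
Proof. by apply/abmapP; rewrite abmap_repr. Qed.

Definition ab_one : abelianization := abmap 1.
Definition ab_mul (c d : abelianization) := abmap (repr c * repr d).
Definition ab_inv (c : abelianization) := abmap (repr c)^-1.

Lemma abmap_mul x y : ab_mul (abmap x) (abmap y) = abmap (x * y).
Proof.
apply/abmapP; rewrite invgM.
set a := repr (abmap x); set b := repr (abmap y).
have [_ dM dV] := comm_subgroupP (@setT G) setT.
suff -> : b^-1 * a^-1 * (x * y) = (a^-1 * x) ^ b * (b^-1 * y).
  by apply: dM; [apply: derived_conjg|]; apply: repr_abmap.
by rewrite /conjg !mulgA mulgK.
Qed.

Lemma abmap_inv x : ab_inv (abmap x) = abmap x^-1.
Proof.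
apply/abmapP; rewrite invgK; set a := repr (abmap x).
have [_ _ dV] := comm_subgroupP (@setT G) setT.
suff -> : a * x^-1 = ((a^-1 * x)^-1) ^ a^-1.
  by apply: derived_conjg; apply: dV; apply: repr_abmap.
by rewrite /conjg invgM !invgK !mulgA mulgK.
Qed.

Lemma ab_ind (P : abelianization -> Prop) :
  (forall x, P (abmap x)) -> forall c, P c.
Proof. by move=> h c; rewrite -[c]abmap_repr. Qed.

Fact ab_mulA : associative ab_mul.
Proof.
elim/ab_ind=> x; elim/ab_ind=> y; elim/ab_ind=> z.
by rewrite !abmap_mul mulgA.
Qed.

Fact ab_mul1 : left_id ab_one ab_mul.
Proof. by elim/ab_ind=> x; rewrite abmap_mul mul1g. Qed.

Fact ab_1mul : right_id ab_one ab_mul.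
Proof. by elim/ab_ind=> x; rewrite abmap_mul mulg1. Qed.

Fact ab_mulV : left_inverse ab_one ab_inv ab_mul.
Proof. by elim/ab_ind=> x; rewrite abmap_inv abmap_mul mulVg. Qed.

Fact ab_Vmul : right_inverse ab_one ab_inv ab_mul.
Proof. by elim/ab_ind=> x; rewrite abmap_inv abmap_mul mulgV. Qed.

HB.instance Definition _ :=
  isGroup.Build abelianization ab_mulA ab_mul1 ab_1mul ab_mulV ab_Vmul.

Lemma abmapM : {morph abmap : x y / x * y}.
Proof. by move=> x y; rewrite -abmap_mul. Qed.
HB.instance Definition _ := isMultiplicative.Build G abelianization abmap abmapM.

Fact abelianization_mulC (c d : abelianization) : c * d = d * c.
Proof.
move: c d; elim/ab_ind=> x; elim/ab_ind=> y; rewrite -!abmapM; apply/abmapP.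
by rewrite invgM -!mulgA; apply: derived_commg.
Qed.

End Abelianization.

Section Automorphisms.
Variable G : groupType.

Record aut := Aut {
  aut_fun :> G -> G;
  autM : {morph aut_fun : x y / x * y};
  aut_bij : bijective aut_fun }.

HB.instance Definition _ := gen_eqMixin aut.
HB.instance Definition _ := gen_choiceMixin aut.

Lemma aut_eqP (s t : aut) : s =1 t <-> s = t.
Proof.
split=> [|-> //]; case: s t => [f fM fb] [g gM gb] /= /funext fg.
by subst g; congr Aut; apply: Prop_irrelevance.
Qed.

Fact aut_oneM : {morph @id G : x y / x * y}. Proof. by []. Qed.
Fact aut_one_bij : bijective (@id G). Proof. by exists id. Qed.
Definition aut_one : aut := Aut aut_oneM aut_one_bij.

(* Automorphisms act on the right: [s x] is x^s, and x^(s t) = (x^s)^t. *)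
Section Mul.
Variables s t : aut.
Fact aut_mulM : {morph t \o s : x y / x * y}.
Proof. by move=> x y; rewrite /= !autM. Qed.
Definition aut_mul : aut := Aut aut_mulM (bij_comp (aut_bij t) (aut_bij s)).
End Mul.

Section Inv.
Variable s : aut.
Fact aut_inv_ex : exists f : G -> G, cancel s f /\ cancel f s.
Proof. by case: (aut_bij s) => f sK fK; exists f. Qed.
Definition aut_inv_fun : G -> G := sval (cid aut_inv_ex).
Fact aut_funK : cancel s aut_inv_fun.
Proof. by rewrite /aut_inv_fun; case: cid => f []. Qed.
Fact aut_inv_funK : cancel aut_inv_fun s.
Proof. by rewrite /aut_inv_fun; case: cid => f []. Qed.
Fact aut_invM : {morph aut_inv_fun : x y / x * y}.
Proof. by move=> x y; apply: (canLR aut_funK); rewrite autM !aut_inv_funK. Qed.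
Definition aut_inv : aut := Aut aut_invM (Bijective aut_inv_funK aut_funK).
End Inv.

Fact aut_mulA : associative aut_mul.
Proof. by move=> s t u; apply/aut_eqP. Qed.
Fact aut_mul1 : left_id aut_one aut_mul.
Proof. by move=> s; apply/aut_eqP. Qed.
Fact aut_1mul : right_id aut_one aut_mul.
Proof. by move=> s; apply/aut_eqP. Qed.
Fact aut_mulV : left_inverse aut_one aut_inv aut_mul.
Proof. by move=> s; apply/aut_eqP; apply: aut_inv_funK. Qed.
Fact aut_Vmul : right_inverse aut_one aut_inv aut_mul.
Proof. by move=> s; apply/aut_eqP; apply: aut_funK. Qed.
HB.instance Definition _ :=
  isGroup.Build aut aut_mulA aut_mul1 aut_1mul aut_mulV aut_Vmul.

Lemma aut1 (s : aut) : s 1 = 1.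
Proof. by apply: (@mulgI _ (s 1)); rewrite -autM !mulg1. Qed.

Lemma autV (s : aut) (x : G) : s x^-1 = (s x)^-1.
Proof. by apply: (@mulgI _ (s x)); rewrite -autM !mulgV aut1. Qed.

Lemma aut_derived (s : aut) (x : G) :
  derived_subgroup _ x -> derived_subgroup _ (s x).
Proof.
have [d1 dM dV] := comm_subgroupP (@setT G) setT.
move=> dx; apply: (dx [set y | derived_subgroup _ (s y)]); split.
  split=> [|y z dy dz|y dy] /=; rewrite ?aut1 ?autM ?autV.
  - exact: d1.
  - exact: dM.
  - exact: dV.
move=> _ /= [y _ [z _ <-]]; rewrite /commg !autM !autV.
exact: derived_commg.
Qed.

Section Inner.
Variable g : G.
Fact innerM : {morph conjg^~ g : x y / x * y}.
Proof. by move=> x y; rewrite conjMg. Qed.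
Definition inner : aut := Aut innerM (Bijective (conjgK g) (conjgKV g)).
End Inner.

End Automorphisms.

Section InducedAutomorphism.
Variables (G : groupType).
Implicit Types (s : aut G) (c : abelianization G).

Definition ab_aut_fun s c : abelianization G := abmap (s (repr c)).

Lemma ab_aut_funE s x : ab_aut_fun s (abmap x) = abmap (s x).
Proof.
apply/abmapP; rewrite -autV -autM; apply: aut_derived; exact: repr_abmap.
Qed.

Fact ab_aut_funM s : {morph ab_aut_fun s : x y / x * y}.
Proof.
elim/ab_ind=> x; elim/ab_ind=> y.
by rewrite -abmapM !ab_aut_funE autM abmapM.
Qed.

Fact ab_aut_fun_bij s : bijective (ab_aut_fun s).
Proof.
exists (ab_aut_fun s^-1); elim/ab_ind=> x; rewrite !ab_aut_funE.
  by congr abmap; apply: aut_funK.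
by congr abmap; apply: aut_inv_funK.
Qed.

Definition ab_aut s : aut (abelianization G) :=
  Aut (ab_aut_funM s) (ab_aut_fun_bij s).

Lemma ab_autM : {morph ab_aut : s t / s * t}.
Proof.
by move=> s t; apply/aut_eqP; elim/ab_ind=> x; rewrite /= !ab_aut_funE.
Qed.
HB.instance Definition _ :=
  isMultiplicative.Build (aut G) (aut (abelianization G)) ab_aut ab_autM.

Definition IA : set (aut G) := [set s | ab_aut s = 1].

End InducedAutomorphism.

Section FreeGroup.
Variable n : nat.

(* The letter (i, b) stands for x_i if b = false and for x_i^-1 if b = true. *)
Definition letter : Type := ('I_n * bool)%type.
HB.instance Definition _ := Choice.on letter.

Implicit Types (a : letter) (w : seq letter).

Definition letter_inv a : letter := (a.1, ~~ a.2).

Definition reduced w : bool := sorted (fun a b => b != letter_inv a) w.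

Record free_group := FreeGroup { word : seq letter; wordP : reduced word }.
HB.instance Definition _ := [isSub for word].
HB.instance Definition _ := [Choice of free_group by <:].

Lemma letter_invK : involutive letter_inv.
Proof. by case=> i b; rewrite /letter_inv /= negbK. Qed.

Definition push a w : seq letter :=
  if w is b :: w' then if b == letter_inv a then w' else a :: w else [:: a].

Definition reduce w : seq letter := foldr push [::] w.

Lemma push_reduced a w : reduced w -> reduced (push a w).
Proof.
rewrite /reduced; case: w => [|b w] //= rw; case: eqVneq => [_|nb]; first exact: path_sorted rw.
by rewrite /= nb.
Qed.

Lemma pushK a w : reduced w -> push (letter_inv a) (push a w) = w.
Proof.
rewrite /reduced; case: w => [|b w] /= rw; first by rewrite letter_invK eqxx.
have [eb|nb] := eqVneq; last by rewrite /= letter_invK eqxx.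
by rewrite {b}eb in rw *; case: w rw => [|c w] //=; rewrite letter_invK; case: eqP.
Qed.

Lemma foldr_push_reduced u w : reduced w -> reduced (foldr push w u).
Proof. by move=> rw; elim: u => //= a u; apply: push_reduced. Qed.

Lemma reduce_reduced w : reduced (reduce w).
Proof. exact: foldr_push_reduced. Qed.

Lemma reduce_id w : reduced w -> reduce w = w.
Proof.
rewrite /reduced; elim: w => //= a w IH rw; rewrite IH ?(path_sorted rw) //.
by case: w rw {IH} => //= b w /andP[/negbTE -> _].
Qed.

Lemma foldr_push_push a s w : reduced s -> reduced w ->
  foldr push w (push a s) = push a (foldr push w s).
Proof.
case: s => [|b s] //= rs rw; case: eqVneq => //= ->.
by rewrite -{1}[a]letter_invK pushK // foldr_push_reduced.
Qed.

Lemma foldr_push_reduce w u : reduced u ->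
  foldr push u (reduce w) = foldr push u w.
Proof.
by move=> ru; elim: w => //= a w IH; rewrite foldr_push_push ?IH ?reduce_reduced.
Qed.

Lemma reduce_cat u w : reduce (u ++ w) = foldr push (reduce w) u.
Proof. exact: foldr_cat. Qed.

Definition fg_one : free_group := @FreeGroup [::] isT.
Definition fg_mul (u v : free_group) : free_group :=
  FreeGroup (reduce_reduced (word u ++ word v)).
Definition fg_inv (u : free_group) : free_group :=
  FreeGroup (reduce_reduced (rev (map letter_inv (word u)))).

Fact fg_mulA : associative fg_mul.
Proof.
move=> u v w; apply/val_inj => /=.
rewrite [LHS]reduce_cat (reduce_id (reduce_reduced _)) reduce_cat.
by rewrite [RHS]reduce_cat foldr_push_reduce ?reduce_reduced // foldr_cat.
Qed.

Fact fg_mul1 : left_id fg_one fg_mul.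
Proof. by move=> u; apply/val_inj; rewrite /= reduce_id ?wordP. Qed.

Fact fg_1mul : right_id fg_one fg_mul.
Proof. by move=> u; apply/val_inj; rewrite /= cats0 reduce_id ?wordP. Qed.

Lemma reduce_cancel w : reduce (rev (map letter_inv w) ++ w) = [::].
Proof.
elim: w => //= a w IH; rewrite rev_cons cat_rcons reduce_cat /=.
by rewrite pushK ?reduce_reduced // -reduce_cat.
Qed.

Fact fg_mulV : left_inverse fg_one fg_inv fg_mul.
Proof.
move=> u; apply/val_inj => /=.
by rewrite reduce_cat foldr_push_reduce ?reduce_reduced // -reduce_cat reduce_cancel.
Qed.

Fact fg_Vmul : right_inverse fg_one fg_inv fg_mul.
Proof.
move=> u; have VV : fg_mul (fg_inv (fg_inv u)) (fg_inv u) = fg_one by apply: fg_mulV.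
by rewrite -[LHS]fg_mul1 -{1}VV -fg_mulA [X in fg_mul _ X]fg_mulA fg_mulV fg_mul1.
Qed.

HB.instance Definition _ :=
  isGroup.Build free_group fg_mulA fg_mul1 fg_1mul fg_mulV fg_Vmul.

Definition gen (i : 'I_n) : free_group := @FreeGroup [:: (i, false)] isT.

Definition letter_elt a : free_group := if a.2 then (gen a.1)^-1 else gen a.1.

Lemma wordE (u : free_group) : \prod_(a <- word u) letter_elt a = u.
Proof.
case: u => w /=; elim: w => [|a w IH] rw; first by rewrite big_nil; apply/val_inj.
rewrite big_cons (IH (path_sorted rw)); apply/val_inj => /=.
have -> : word (letter_elt a) = [:: a] by case: a {rw} => i [].
by rewrite -[RHS](reduce_id rw).
Qed.

End FreeGroup.

Arguments gen {n} i.

(* Z[G] consists of the finitely supported functions from G to the integers;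
   the ring structure of [malg] is only available over monoids without
   nontrivial units, so the convolution product is defined here. *)
Section GroupRing.
Variable G : groupType.
Local Open Scope ring_scope.

Definition group_ring : Type := {malg int[G]}.
HB.instance Definition _ := GRing.Zmodule.on group_ring.

Definition gr_elt (g : G) : group_ring := << 1 *g g >>.

Definition gr_lift (V : zmodType) (f : G -> V) (u : group_ring) : V :=
  \sum_(g <- msupp u) f g *~ u@_g.

Lemma gr_liftw (V : zmodType) (f : G -> V) (u : group_ring) (d : {fset G}) :
  (msupp u `<=` d)%fset -> gr_lift f u = \sum_(g <- d) f g *~ u@_g.
Proof.
move=> le_d; rewrite /gr_lift (big_fset_incl _ le_d) //=.
by move=> g _ /mcoeff_outdom ->; rewrite mulr0z.
Qed.

Lemma gr_liftD (V : zmodType) (f : G -> V) : {morph gr_lift f : u v / u + v}.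
Proof.
move=> u v; rewrite (gr_liftw _ (msuppD_le u v)).
rewrite (gr_liftw f (fsubsetUl (msupp u) (msupp v))).
rewrite (gr_liftw f (fsubsetUr (msupp u) (msupp v))) -big_split /=.
by apply: eq_bigr => g _; rewrite mcoeffD mulrzDr.
Qed.

Lemma gr_lift0 (V : zmodType) (f : G -> V) : gr_lift f 0 = 0.
Proof. by rewrite /gr_lift msupp0 big_seq_fset0. Qed.

HB.instance Definition _ (V : zmodType) (f : G -> V) :=
  GRing.isNmodMorphism.Build group_ring V (gr_lift f)
    (gr_lift0 f, gr_liftD f).

Lemma gr_lift_elt (V : zmodType) (f : G -> V) g : gr_lift f (gr_elt g) = f g.
Proof.
rewrite (gr_liftw f (d := [fset g]%fset)) ?msuppU_le // big_seq_fset1.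
by rewrite mcoeffUU.
Qed.

Definition gr_one : group_ring := gr_elt 1%g.

Definition gr_mul (u v : group_ring) : group_ring :=
  \sum_(g <- msupp u) \sum_(h <- msupp v) << u@_g * v@_h *g (g * h)%g >>.

Lemma gr_mulw (d1 d2 : {fset G}) (u v : group_ring) :
  (msupp u `<=` d1)%fset -> (msupp v `<=` d2)%fset ->
  gr_mul u v =
  \sum_(g <- d1) \sum_(h <- d2) << u@_g * v@_h *g (g * h)%g >>.
Proof.
move=> le_d1 le_d2; rewrite /gr_mul (big_fset_incl _ le_d1) /=.
  apply/eq_bigr=> g _; apply/big_fset_incl => // h _ /mcoeff_outdom ->.
  by rewrite mulr0 monalgU0.
move=> g _ /mcoeff_outdom ug.
by rewrite big1 // => h _; rewrite ug mul0r monalgU0.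
Qed.

Lemma gr_mulDl : left_distributive gr_mul +%R.
Proof.
move=> u v w.
rewrite (gr_mulw (msuppD_le u v) (fsubset_refl _)).
rewrite (gr_mulw (fsubsetUl (msupp u) (msupp v)) (fsubset_refl (msupp w))).
rewrite (gr_mulw (fsubsetUr (msupp u) (msupp v)) (fsubset_refl (msupp w))).
rewrite -big_split; apply/eq_bigr=> g _; rewrite -big_split; apply/eq_bigr=> h _.
by rewrite mcoeffD mulrDl monalgUD.
Qed.

Lemma gr_mulDr : right_distributive gr_mul +%R.
Proof.
move=> w u v.
rewrite (gr_mulw (fsubset_refl _) (msuppD_le u v)).
rewrite (gr_mulw (fsubset_refl (msupp w)) (fsubsetUl (msupp u) (msupp v))).
rewrite (gr_mulw (fsubset_refl (msupp w)) (fsubsetUr (msupp u) (msupp v))).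
rewrite -big_split; apply/eq_bigr=> g _; rewrite -big_split; apply/eq_bigr=> h _.
by rewrite mcoeffD mulrDr monalgUD.
Qed.

Lemma gr_mul0r : left_zero 0 gr_mul.
Proof. by move=> u; rewrite /gr_mul msupp0 big_seq_fset0. Qed.

Lemma gr_mulr0 : right_zero 0 gr_mul.
Proof.
by move=> u; rewrite /gr_mul big1 // => g _; rewrite msupp0 big_seq_fset0.
Qed.

Lemma gr_mulUU a b (g h : G) :
  gr_mul << a *g g >> << b *g h >> = << a * b *g (g * h)%g >>.
Proof. by rewrite (gr_mulw msuppU_le msuppU_le) !big_seq_fset1 !mcoeffUU. Qed.

Lemma gr_ind (P : group_ring -> Prop) :
  P 0 -> (forall u v, P u -> P v -> P (u + v)) ->
  (forall a g, P << a *g g >>) -> forall u, P u.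
Proof. by move=> P0 PD PU u; rewrite [u]monalgE; apply: big_ind. Qed.

Fact gr_mulA : associative gr_mul.
Proof.
move=> u v w.
elim/gr_ind: u => [|u1 u2 IH1 IH2|a g]; first by rewrite !gr_mul0r.
  by rewrite !gr_mulDl IH1 IH2.
elim/gr_ind: v => [|v1 v2 IH1 IH2|b h]; first by rewrite !(gr_mul0r, gr_mulr0).
  by rewrite !(gr_mulDl, gr_mulDr) IH1 IH2.
elim/gr_ind: w => [|w1 w2 IH1 IH2|c k]; first by rewrite !gr_mulr0.
  by rewrite !gr_mulDr IH1 IH2.
by rewrite !gr_mulUU mulrA mulgA.
Qed.

Fact gr_mul1 : left_id gr_one gr_mul.
Proof.
elim/gr_ind=> [|u v IHu IHv|a g]; first by rewrite gr_mulr0.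
  by rewrite gr_mulDr IHu IHv.
by rewrite gr_mulUU mul1r mul1g.
Qed.

Fact gr_1mul : right_id gr_one gr_mul.
Proof.
elim/gr_ind=> [|u v IHu IHv|a g]; first by rewrite gr_mul0r.
  by rewrite gr_mulDl IHu IHv.
by rewrite gr_mulUU mulr1 mulg1.
Qed.

Fact gr_one_neq0 : gr_one != 0.
Proof. by apply/eqP=> /malgP/(_ 1%g)/eqP; rewrite mcoeffUU mcoeff0. Qed.

HB.instance Definition _ := GRing.Zmodule_isNzRing.Build group_ring
  gr_mulA gr_mul1 gr_1mul gr_mulDl gr_mulDr gr_one_neq0.

End GroupRing.

Notation "''Z[' G ]" := (group_ring G) (format "''Z[' G ]") : type_scope.

Section Magnus.
Variable n : nat.
Local Open Scope ring_scope.
Let F := free_group n.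
Let H := abelianization F.

(* For w = x_{mu_1}^{eps_1} ... x_{mu_r}^{eps_r}, the summand at a = (mu_j, eps_j)
   is eps_j delta_{mu_j,i} x_{mu_1}^{eps_1} ... x_{mu_{j-1}}^{eps_{j-1}}
   x_{mu_j}^{(eps_j - 1)/2}, where eps_j = (-1) ^+ a.2. *)
Definition fox_word (i : 'I_n) (w : seq (letter n)) : 'Z[F] :=
  \sum_(j < size w)
    let a := tnth (in_tuple w) j in
    gr_elt ((\prod_(b <- take j w) letter_elt b)
              * (if a.2 then (gen a.1)^-1 else 1))%g
      *~ ((-1) ^+ a.2 * (a.1 == i)%:R).

Definition fox (i : 'I_n) : 'Z[F] -> 'Z[F] :=
  gr_lift (fun w : F => fox_word i (word w)).

Definition ab_ring : 'Z[F] -> 'Z[H] := gr_lift (fun g : F => gr_elt (abmap g)).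

Definition magnus (s : aut F) : 'M['Z[H]]_n :=
  \matrix_(i, j) ab_ring (fox j (gr_elt (s (gen i)))).

Definition magnus_kernel : set (aut F) :=
  [set s | IA s /\ magnus s = 1%:M].

End Magnus.

Arguments magnus_kernel n : clear implicits.

(* Main.v *)
Require Import Defs.
From HB Require Import structures.
From mathcomp Require Import ssreflect ssrfun ssrbool eqtype ssrnat seq choice.
From mathcomp Require Import path fintype tuple bigop generic_quotient.
From mathcomp Require Import order ssralg ssrnum ssrint matrix finmap monalg.
From mathcomp Require Import zify.
From mathcomp Require Import boolp.
From mathcomp Require Import monoid classical_sets.

Local Open Scope classical_set_scope.
Set Implicit Arguments.
Unset Strict Implicit.
Unset Printing Implicit Defensive.

Import GRing.Theory Num.Theory Order.Theory.
Local Open Scope group_scope.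

(** The kernel of the Magnus representation consists of IA-automorphisms, and
    those of F_2 are inner, so the question is for which g the automorphism
    x |-> g^-1 x g has the identity as Magnus matrix.  Write D_j g for the image
    of the Fox derivative of g in Z[H], and let a bar denote the passage from F
    to H.  The product rule gives (dfoxJ)
      \bar g * M_ij = delta_ij + (\bar x_i - 1) * D_j g,
    where M is the Magnus matrix of the automorphism.  If M is the identity, the
    entries with i <> j say that (\bar x_i - 1) * D_j g = 0.  Multiplication by
    \bar x_i - 1 is injective because \bar x_i raises the x_i-exponent sum by
    one (gr_elt_sub1_reg), so all D_j g vanish; a diagonal entry then shows that
    g lies in F'.  Conversely D_j is additive on F', hence kills F''.

    What remains of this half is that an element of F' with vanishing D_j lies
    in F'' (fox_eq0_second_derived).  Read g as a path in the Cayley graph of H.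
    A choice of coset representatives attaches to each edge an element of F',
    and telescoping writes g, up to conjugacy, as the product of the elements
    attached to the edges of its path.  Modulo F'' this product only depends on
    how often each edge is traversed, with sign, and these numbers are the
    coefficients of the D_j g.  Hence the class of g in F' / F'' is the value of
    an additive map at the D_j g (edge_sum_fox).

    The other half is Nielsen's theorem that every IA-automorphism s of F_2 is
    inner (IA2_inner).  It has two ingredients.  The first is Nielsen reduction
    (nielsen_induction): a property of pairs that holds for the basis and is
    preserved by the elementary Nielsen moves and by simultaneous conjugation
    holds for all generating pairs.  It is applied to the following property:
    up to conjugation and inversion of either entry, the pair arises from two
    letters a, b with distinct indices by the moves (u, v) |-> (u v, v) and
    (u, v) |-> (u, v u) only.  The delicate case of its invariance is (u v^-1, v),
    where v^-1 undoes or reroutes the last positive move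
    (positive_pair_div).  The second ingredient is a homomorphism to the
    integers that takes the value 1 on a and on b: every positive move brings
    some entry to a value of at least 2, whereas the entries that come from s
    have values 1 or -1.  So no move was made, and s is a conjugation on the
    generators. *)

(** * Words and elements of the free group *)

Section FreeGroupWords.
Variable n : nat.
Local Notation F := (free_group n).
Implicit Types (a b : letter n) (w p s t : seq (letter n)) (g h k : F).

Definition of_word w : F := FreeGroup (reduce_reduced w).

Definition word_inv w : seq (letter n) := rev (map (@letter_inv n) w).

Lemma word_of_word w : reduced w -> word (of_word w) = w.
Proof. exact: reduce_id. Qed.

Lemma of_wordK g : of_word (word g) = g.
Proof. by apply/val_inj; rewrite /= reduce_id ?wordP. Qed.

Lemma of_word_cat w t : of_word (w ++ t) = of_word w * of_word t.
Proof.
apply/val_inj => /=.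
by rewrite !reduce_cat (reduce_id (reduce_reduced t)) foldr_push_reduce ?reduce_reduced.
Qed.

Lemma of_word_inv w : of_word (word_inv w) = (of_word w)^-1.
Proof.
apply: (mulIg (of_word w)); rewrite mulVg -of_word_cat.
by apply/val_inj; rewrite /= reduce_cancel.
Qed.

Lemma letter_elt_word a : letter_elt a = of_word [:: a].
Proof. by case: a => i [] /=; apply/val_inj. Qed.

Lemma letter_elt_inv a : letter_elt (letter_inv a) = (letter_elt a)^-1.
Proof. by case: a => i [] //=; rewrite /letter_elt /= invgK. Qed.

Lemma letter_inv_neq a : letter_inv a != a.
Proof. by case: a => i []; rewrite /letter_inv xpair_eqE /= andbF. Qed.

Lemma word_inv_reduced w : reduced w -> reduced (word_inv w).
Proof.
rewrite /reduced /word_inv rev_sorted sorted_map; apply: sub_sorted => a b /=.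
by rewrite letter_invK eq_sym.
Qed.

Lemma wordV g : word g^-1 = word_inv (word g).
Proof.
rewrite -{1}[g]of_wordK -of_word_inv word_of_word //.
exact/word_inv_reduced/wordP.
Qed.

Lemma word_invK : involutive word_inv.
Proof.
move=> w; rewrite /word_inv map_rev revK -map_comp.
by rewrite (eq_map (g := id)) ?map_id // => a /=; rewrite letter_invK.
Qed.

Lemma size_word_inv w : size (word_inv w) = size w.
Proof. by rewrite size_rev size_map. Qed.

Lemma reduced_cat_head w t a b :
  reduced (rcons w a) -> reduced (b :: t) -> b != letter_inv a ->
  reduced (rcons w a ++ b :: t).
Proof.
rewrite /reduced; case: w => [|c w] /=; first by move=> _ -> ->.
by rewrite cat_path last_rcons /= => -> -> ->.
Qed.

(** * The word length and the common prefix of two elements *)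

Definition len g : nat := size (word g).

Lemma len1 : len 1 = 0. Proof. by []. Qed.

Lemma len_eq0 g : (len g == 0) = (g == 1).
Proof.
by rewrite /len; apply/nilP/eqP => [w0|->//]; apply/val_inj.
Qed.

Lemma lenV g : len g^-1 = len g.
Proof. by rewrite /len wordV size_word_inv. Qed.

Lemma len_of_word w : (len (of_word w) <= size w)%N.
Proof.
rewrite /len /=; elim: w => //= a w IH.
rewrite /push; case: (reduce w) IH => [|b v] //= lw.
by case: ifP => _ /=; lia.
Qed.

Lemma lenM g h : (len (g * h)%g <= len g + len h)%N.
Proof.
rewrite -[g in len (g * _)]of_wordK -[h in len (_ * h)]of_wordK -of_word_cat.
by rewrite (leq_trans (len_of_word _)) // size_cat.
Qed.

Fixpoint common_prefix w t : nat :=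
  match w, t with
  | a :: w', b :: t' => if a == b then (common_prefix w' t').+1 else 0
  | _, _ => 0
  end.

Definition lcp g h : nat := common_prefix (word g) (word h).

Lemma common_prefixC : commutative common_prefix.
Proof. by elim=> [|a w IH] [|b t] //=; rewrite eq_sym IH. Qed.

Lemma lcpC g h : lcp g h = lcp h g.
Proof. exact: common_prefixC. Qed.

Lemma common_prefix_take w t m :
  (m <= size w)%N -> (m <= common_prefix w t)%N = (take m w == take m t).
Proof.
elim: w t m => [|a w IH] [|b t] [|m] //=; rewrite ltnS => lm.
by rewrite eqseq_cons -IH //; case: eqP => //=; rewrite ltnS.
Qed.

Lemma common_prefix_ge w t m : (m <= common_prefix w t)%N ->
  [/\ (m <= size w)%N, (m <= size t)%N & take m w = take m t].
Proof.
elim: w t m => [|a w IH] [|b t] [|m] //=; case: eqP => // -> lm.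
by have [] := IH t m lm; split=> //; congr cons.
Qed.

(** Agreement of prefixes of a given length is an equivalence relation.  With
    len_divl this says that the Cayley tree is 0-hyperbolic, and it replaces
    all tracking of cancellations in long products. *)
Lemma lcp_ultra g h k : (minn (lcp g h) (lcp h k) <= lcp g k)%N.
Proof.
set m := minn _ _.
have [lg _ gh] : [/\ m <= size (word g), m <= size (word h) &
  take m (word g) = take m (word h)]%N by apply: common_prefix_ge; exact: geq_minl.
have [_ _ hk] : [/\ m <= size (word h), m <= size (word k) &
  take m (word h) = take m (word k)]%N by apply: common_prefix_ge; exact: geq_minr.
by rewrite /lcp common_prefix_take // gh hk.
Qed.

Lemma common_prefix_split w t : exists p w' t',
  [/\ w = p ++ w', t = p ++ t', size p = common_prefix w t
    & forall a b u v, w' = a :: u -> t' = b :: v -> a != b].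
Proof.
elim: w t => [|a w IH] [|b t] /=.
- by exists [::], [::], [::].
- by exists [::], [::], (b :: t).
- by exists [::], (a :: w), [::].
- have [->|nab] := eqVneq.
    have [p [w' [t' [-> -> <- H]]]] := IH t.
    by exists (b :: p), w', t'.
  by exists [::], (a :: w), (b :: t); split=> // c d u v [<- _] [<- _].
Qed.

Lemma reduced_catr p s : reduced (p ++ s) -> reduced s.
Proof.
elim: p => //= a p IH /path_sorted; exact: IH.
Qed.

(** The letters that cancel in g^-1 h are those of the common prefix of g and
    h, once in each factor. *)
Lemma len_divl g h : (len (g^-1 * h)%g + (lcp g h).*2 = len g + len h)%N.
Proof.
have [p [s [t [gE hE pE Hst]]]] := common_prefix_split (word g) (word h).
have rs : reduced s by apply: (@reduced_catr p); rewrite -gE wordP.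
have rt : reduced t by apply: (@reduced_catr p); rewrite -hE wordP.
have -> : g^-1 * h = of_word (word_inv s ++ t).
  rewrite -[g]of_wordK -[h]of_wordK gE hE !of_word_cat of_word_inv invgM.
  by rewrite -mulgA mulKg.
rewrite {1}/len word_of_word.
  rewrite /lcp -pE /len gE hE !size_cat size_word_inv; lia.
have := word_inv_reduced rs.
case: s t rs rt gE hE Hst => [|a s] [|b t] rs rt gE hE Hst //; rewrite ?cats0 //.
rewrite /word_inv /= rev_cons => rs'; apply: reduced_cat_head => //.
by rewrite letter_invK eq_sym (Hst _ _ _ _ erefl erefl).
Qed.

Lemma lenM_lcp g h : (len (g * h)%g + (lcp g^-1%g h).*2 = len g + len h)%N.
Proof. by have := len_divl g^-1 h; rewrite invgK lenV. Qed.

(** If g^-1 and g shared a prefix of half the length of g, then reading g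
    backwards would invert its letters up to the middle.  There, a letter would
    be its own inverse or two neighbours would cancel, according to the parity
    of the length. *)
Lemma lcp_inv_self g : g != 1 -> ((lcp g^-1%g g).*2 < len g)%N.
Proof.
rewrite -len_eq0 /len; set w := word g => w0; rewrite ltnNge; apply/negP => le_w.
have [a0 _] : exists a0 : letter n, True by case: (w) w0 => // a; exists a.
pose m := uphalf (size w).
have lm : (m <= common_prefix (word g^-1) w)%N by rewrite /m -/(lcp g^-1 g); lia.
have [_ lmw] := common_prefix_ge lm; rewrite wordV -/w => tE.
have wi i : (i < m)%N -> nth a0 w i = letter_inv (nth a0 w (size w - i.+1)).
  move=> im; rewrite -[LHS](nth_take _ im) -tE nth_take //.
  by rewrite nth_rev ?size_map ?(nth_map a0) //; rewrite /m in im; lia.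
case: (boolP (odd (size w))) => ow.
  have := wi (size w)./2 ltac:(rewrite /m; lia).
  have -> : (size w - (size w)./2.+1 = (size w)./2)%N by lia.
  by move/esym/eqP; rewrite (negbTE (letter_inv_neq _)).
have := wi m.-1 ltac:(rewrite /m; lia).
have -> : (size w - m.-1.+1 = m)%N by rewrite /m; lia.
move=> eqw; have := wordP g; rewrite /reduced -/w => /(sortedP a0)/(_ m.-1).
have -> : m.-1.+1 = m by rewrite /m; lia.
by rewrite eqw letter_invK eqxx => /(_ ltac:(rewrite /m; lia)).
Qed.

End FreeGroupWords.

(** * Nielsen reduction in rank two *)

Section ReducedProducts.
Variables (m n : nat) (e : letter m -> free_group n).

Hypothesis e_gt0 : forall a, (0 < len (e a))%N.
Hypothesis e_cancel : forall a b, b != letter_inv a ->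
  ((lcp (e a)^-1%g (e b)).*2 <= len (e a))%N /\
  ((lcp (e a)^-1%g (e b)).*2 <= len (e b))%N.
Hypothesis e_overlap : forall a b c, b != letter_inv a -> c != letter_inv b ->
  (lcp (e a)^-1%g (e b) + lcp (e b)^-1%g (e c) < len (e b))%N.

(** Cancellation at the two ends of a factor never meets (e_overlap), so each
    factor leaves a letter of its own in the product. *)
Lemma size_reduced_prod w : reduced w ->
  (size w <= len (\prod_(a <- w) e a)%g)%N.
Proof.
case: w => // a w rw.
pose c := if w is b :: _ then lcp (e a)^-1 (e b) else 0.
(* Besides the length, the induction carries how much of e a survives in the
   product: all of it except the c letters that cancel against the next
   factor. *)
suff [cE [H _]] : (c.*2 <= len (e a))%N /\
    (size w + len (e a) <= len (\prod_(b <- a :: w) e b)%g + c)%N /\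
    (lcp (\prod_(b <- a :: w) e b)%g (e a) + c = len (e a))%N.
  by have := e_gt0 a; move: cE H; clearbody c; rewrite /=; lia.
rewrite {}/c; elim: w a rw => [|b w IH] a rw.
  rewrite big_seq1 /=; split; first by lia.
  by have := len_divl (e a) (e a); rewrite mulVg len1; lia.
have ab : b != letter_inv a by case/andP: rw.
have [cb [lh lcb]] := IH b (path_sorted rw).
rewrite big_cons; set h := \prod_(c <- b :: w) e c in lh lcb *.
have [ca1 ca2] := e_cancel ab.
have ov : (lcp (e a)^-1%g (e b) + (if w is d :: _ then lcp (e b)^-1%g (e d) else 0)
    < len (e b))%N.
  have := e_gt0 b; case: (w) rw => [_|d w' /= /and3P[_ db _] _]; first by lia.
  exact: e_overlap.
have u1 := lcp_ultra (e a)^-1 (e b) h; have u2 := lcp_ultra (e a)^-1 h (e b).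
rewrite (lcpC (e b) h) in u1.
have lp := lenM_lcp (e a) h; have := len_divl (e a) (e a * h); rewrite mulKg lcpC => ld.
(* The product h of the remaining factors keeps more of e b than e a cancels,
   so e a does not see the difference between h and e b. *)
have eqc : lcp (e a)^-1 h = lcp (e a)^-1 (e b).
  move: ov lcb u1 u2; set x := lcp _ (e b); set y := lcp _ h; set z := lcp h _.
  by case: (w) => [|d w']; lia.
rewrite eqc in lp; move: ov lcb lh lp ld ca1 ca2 => /=.
by case: (w) => [|d w'] /=; lia.
Qed.

End ReducedProducts.

Section Moves.
Variable G : groupType.
Implicit Types (P : G -> G -> Prop) (u v g h : G).

(** Stability under the elementary Nielsen moves and simultaneous conjugation;
    the remaining moves are composites of these. *)
Record nielsen_closed P : Prop := NielsenClosed {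
  nielsen_swap : forall u v, P u v -> P v u;
  nielsen_inv : forall u v, P u v -> P u^-1 v;
  nielsen_mul : forall u v, P u v -> P (u * v) v;
  nielsen_conj : forall g u v, P u v -> P (u ^ g) (v ^ g) }.

Definition generates u v : Prop :=
  forall A : set G, is_subgroup A -> A u -> A v -> forall g, A g.

Lemma generates_closed : nielsen_closed generates.
Proof.
split=> [u v uv A sA Av Au|u v uv A sA Au Av|u v uv A sA Auv Av|g u v uv A sA Au Av].
- exact: uv.
- by apply: uv => //; case: sA => _ _ AV; rewrite -[u]invgK; apply: AV.
- by apply: uv => //; case: sA => _ AM AV; rewrite -(mulgK v u); apply: AM => //; apply: AV.
- have [A1 AM AV] := sA; move=> h; rewrite -(conjgKV g h).
  apply: (uv [set k | A (k ^ g)]) => //; split=> [|x y|x] /=.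
  + by rewrite conj1g.
  + by rewrite conjMg; apply: AM.
  + by rewrite conjVg; apply: AV.
Qed.

Variables (P : G -> G -> Prop) (Pcl : nielsen_closed P).

Lemma nielsen_invr u v : P u v -> P u v^-1.
Proof. by move=> /(nielsen_swap Pcl)/(nielsen_inv Pcl)/(nielsen_swap Pcl). Qed.

Lemma nielsen_mulE u v : P (u * v) v <-> P u v.
Proof.
split=> [/nielsen_invr/(nielsen_mul Pcl)/nielsen_invr|/(nielsen_mul Pcl) //].
by rewrite mulgK invgK.
Qed.

Lemma nielsen_conjE g u v : P (u ^ g) (v ^ g) <-> P u v.
Proof. by split=> /(nielsen_conj Pcl) => [/(_ g^-1)|]; rewrite ?conjgK. Qed.

Lemma nielsen_mulrE u v : P u (u * v) <-> P u v.
Proof.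
have S w t : P w t <-> P t w by split; apply: (nielsen_swap Pcl).
rewrite S -(nielsen_conjE u) [u ^ u]mulKg /conjg -mulgA mulKg.
by rewrite nielsen_mulE S.
Qed.

End Moves.

Definition pair_elt (G : groupType) (u v : G) (a : letter 2) : G :=
  let g := if a.1 == ord0 then u else v in if a.2 then g^-1 else g.

Section PairElt.
Variables (G : groupType) (u v : G).
Local Notation e := (pair_elt u v).

Lemma pair_elt_inv a : e (letter_inv a) = (e a)^-1.
Proof. by case: a => i []; rewrite /pair_elt /= ?invgK. Qed.

Lemma pair_eltE P (Pcl : nielsen_closed P) a b : a.1 != b.1 ->
  P (e a) (e b) <-> P u v.
Proof.
have S w t : P w t <-> P t w by split; apply: (nielsen_swap Pcl).
have I w t : P w^-1 t <-> P w t.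
  by split=> /(nielsen_inv Pcl); rewrite ?invgK.
have J w t : P w t^-1 <-> P w t by rewrite S I S.
case: a b => [[[|[]] //= ?] []] [[[|[]] //= ?] []] // _;
  by rewrite /pair_elt /= ?(I, J) // S.
Qed.

(** Substituting u and v for the two generators is compatible with free
    reduction, so reduced words give all the products. *)
Lemma reduced_products_subgroup :
  is_subgroup [set g | exists2 w, reduced w & g = \prod_(a <- w) e a].
Proof.
have prodR w : \prod_(a <- reduce w) e a = \prod_(a <- w) e a.
  elim: w => //= a w IH; rewrite big_cons -IH /push.
  case: (reduce w) => [|b t]; first by rewrite big_seq1 big_nil mulg1.
  by case: eqP => [->|_]; rewrite !big_cons // pair_elt_inv mulVKg.
split=> [|_ _ [w rw ->] [t rt ->]|_ [w rw ->]].
- by exists [::]; rewrite ?big_nil.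
- by exists (reduce (w ++ t)); rewrite ?reduce_reduced // prodR big_cat.
- exists (word_inv w); first exact: word_inv_reduced.
  elim: w {rw} => [|a w IH]; first by rewrite !big_nil invg1.
  rewrite big_cons invgM IH /word_inv /= rev_cons -cats1 big_cat /= big_seq1.
  by rewrite pair_elt_inv.
Qed.

Lemma generates_reduced_prod g : generates u v ->
  exists2 w, reduced w & g = \prod_(a <- w) e a.
Proof.
move=> guv; apply: (guv _ reduced_products_subgroup).
  by exists [:: (ord0, false)]; rewrite ?big_seq1.
by exists [:: (ord_max, false)]; rewrite ?big_seq1.
Qed.

End PairElt.

Section NielsenReduction.
Local Notation F := (free_group 2).
Implicit Types (g h u v : F).

(** This replaces the classical tie-breaking order on words of equal length.
    Here u = p q^-1 with halves of equal length that cancel against w on both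
    sides, that is w = q t p^-1.  Then w u = q t q^-1, and conjugating the pair
    (u, w u) by q gives (q^-1 p, t), where t is shorter than w by the length of
    u. *)
Lemma overlap_shortening u w m : u != 1 -> len u = m.*2 ->
  (m <= lcp w^-1 u)%N -> (m <= lcp u^-1 w)%N -> (m.*2 <= len w)%N ->
  exists q, (len (u ^ q)%g + len ((w * u) ^ q)%g < len u + len w)%N.
Proof.
rewrite -len_eq0 => u0 uE wu uw lw.
have [_ _ pE] := common_prefix_ge wu; have [_ _ qE] := common_prefix_ge uw.
pose p := of_word (take m (word u)); pose q := of_word (take m (word w)).
have lp : (len p <= m)%N by rewrite (leq_trans (len_of_word _)) // size_take_min geq_minl.
have lq : (len q <= m)%N by rewrite (leq_trans (len_of_word _)) // size_take_min geq_minl.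
have szu : size (word u) = m.*2 by [].
have uqp : u = p * q^-1.
  rewrite /p /q -qE wordV -of_word_inv -of_word_cat /word_inv take_rev -map_drop.
  rewrite size_map -/(word_inv _) word_invK szu.
  have -> : (m.*2 - m = m)%N by lia.
  by rewrite cat_take_drop of_wordK.
pose t := of_word (take (len w - m.*2) (drop m (word w))).
have lt : (len t <= len w - m.*2)%N.
  by rewrite (leq_trans (len_of_word _)) // size_take_min geq_minl.
have wqp : w = q * t * p^-1.
  rewrite /p /q /t -pE wordV -of_word_inv /word_inv take_rev -map_drop size_map.
  rewrite -/(word_inv _) word_invK -!of_word_cat -catA.
  have -> : drop (size (word w) - m) (word w) =
      drop (len w - m.*2) (drop m (word w)).
    by rewrite drop_drop; congr drop; rewrite /len in lw *; lia.
  by rewrite !cat_take_drop of_wordK.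
exists q.
have -> : u ^ q = q^-1 * p by rewrite uqp /conjg mulgVK.
have -> : (w * u) ^ q = t.
  by rewrite uqp wqp /conjg !mulgA mulgVK mulVg mul1g mulgVK.
apply: leq_ltn_trans (leq_add (lenM _ _) lt) _; rewrite lenV; lia.
Qed.

Lemma letter2_eq (a c : letter 2) : a.1 = c.1 -> a = c \/ a = letter_inv c.
Proof.
by case: a c => [i []] [j []] /= ->; [left|right|right|left].
Qed.

Lemma ord2_neq (i j k : 'I_2) : i != j -> k != j -> i = k.
Proof.
by case: i j k => [[|[]] //= ?] [[|[]] //= ?] [[|[]] //= ?] // _ _; apply/val_inj.
Qed.

Lemma neq_gen2 : gen ord0 * gen ord_max != gen ord_max * gen ord0 :> F.
Proof. by apply/eqP => /(congr1 (@word 2)). Qed.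

(** Otherwise the group would be generated by v alone, hence abelian. *)
Lemma generates_neq1 u v : generates u v -> u != 1.
Proof.
move=> uv; apply/eqP => u1; move: neq_gen2; apply/negP; rewrite negbK; apply/eqP.
have cS (h : F) : is_subgroup [set g | commute g h].
  split=> [|x y|x] /=; first exact/commute_sym/commute1.
    by move=> /commute_sym xh /commute_sym yh; apply/commute_sym/commuteM.
  by move=> /commute_sym xh; apply/commute_sym/commuteV.
have cv g : commute g v.
  by apply: (uv _ (cS v)) => //=; rewrite u1; apply/commute_sym/commute1.
apply: (uv _ (cS (gen ord_max))) => /=; last exact/commute_sym/cv.
by rewrite u1; apply/commute_sym/commute1.
Qed.

(** Induction on the total length of the pair.  If some Nielsen move shortens
    the pair, perhaps after a conjugation, the induction hypothesis applies.  If
    none does, size_reduced_prod applies to u and v, so a generator, being of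
    length 1, can only be a product of one factor: u and v are the two
    generators up to order and inversion. *)
Lemma nielsen_induction (P : F -> F -> Prop) :
  nielsen_closed P -> P (gen ord0) (gen ord_max) ->
  forall u v, generates u v -> P u v.
Proof.
move=> Pcl P0 u v; have [k] := ubnP (len u + len v).
elim: k u v => // k IH u v luv guv.
have Gcl := @generates_closed F.
pose e : letter 2 -> F := pair_elt u v.
have eV a : e (letter_inv a) = (e a)^-1 by apply: pair_elt_inv.
have lene a b : a.1 != b.1 -> (len (e a) + len (e b) = len u + len v)%N.
  case: a b => [[[|[]] //= ?] []] [[[|[]] //= ?] []] // _;
    by rewrite /e /pair_elt /= ?lenV // addnC.
have [/asboolP//|/asboolPn notP] := boolP `[< P u v >].
(* A shorter pair equivalent to (u, v) would have P by induction, and P would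
   carry over to (u, v). *)
have nshort a b g h : a.1 != b.1 ->
    (forall Q, nielsen_closed Q -> Q g h <-> Q (e a) (e b)) ->
    (len u + len v <= len g + len h)%N.
  move=> ab eqQ; rewrite leqNgt; apply/negP => lt; apply: notP.
  apply/(pair_eltE u v Pcl ab)/(eqQ P Pcl)/IH; first by lia.
  by apply/(eqQ _ Gcl)/(pair_eltE u v Gcl ab).
have e_neq1 a : e a != 1.
  have [b ab] : exists b : letter 2, a.1 != b.1.
    by case: a => [[[|[]] //= ?] c]; [exists (ord_max, c)|exists (ord0, c)].
  by apply: (@generates_neq1 _ (e b)); apply/(pair_eltE u v Gcl ab).
have e_gt0 a : (0 < len (e a))%N by rewrite lt0n len_eq0.
have e_cancel a b : b != letter_inv a ->
    ((lcp (e a)^-1%g (e b)).*2 <= len (e a))%N /\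
    ((lcp (e a)^-1%g (e b)).*2 <= len (e b))%N.
  move=> ab; have lM := lenM_lcp (e a) (e b).
  have [ab1|ab1] := eqVneq a.1 b.1.
    have [ba|ba] := letter2_eq ab1; last by rewrite ba letter_invK eqxx in ab.
    by have := lcp_inv_self (e_neq1 b); rewrite ba; lia.
  have le := lene _ _ ab1.
  have := nshort a b (e a * e b) (e b) ab1
    (fun Q Qcl => nielsen_mulE Qcl (e a) (e b)).
  have := nshort a b (e a) (e a * e b) ab1
    (fun Q Qcl => nielsen_mulrE Qcl (e a) (e b)).
  lia.
have e_overlap a b c : b != letter_inv a -> c != letter_inv b ->
    (lcp (e a)^-1%g (e b) + lcp (e b)^-1%g (e c) < len (e b))%N.
  move=> ab bc; have [ca cb] := e_cancel a b ab; have [cb' cc] := e_cancel b c bc.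
  rewrite ltnNge; apply/negP => le_b.
  have self := lcp_inv_self (e_neq1 b).
  have [ab1|ab1] := eqVneq a.1 b.1.
    have [ba|ba] := letter2_eq ab1; last by rewrite ba letter_invK eqxx in ab.
    by rewrite ba in le_b; lia.
  have [cb1|cb1] := eqVneq c.1 b.1.
    have [E|E] := letter2_eq cb1; last by rewrite E eqxx in bc.
    by rewrite E in le_b; lia.
  (* In rank two a and c have the same index.  If c is the inverse of a, the
     first halves of e b and of its inverse are both prefixes of e c, so they
     agree. *)
  have [ac|ac] := letter2_eq (ord2_neq ab1 cb1); last first.
    have := lcp_ultra (e b)^-1 (e c) (e b).
    by rewrite ac eV invgK in le_b ca cb; lia.
  subst c; pose m := lcp (e a)^-1 (e b).
  have bE : len (e b) = m.*2 by rewrite /m; lia.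
  have [q lq] := overlap_shortening (e_neq1 b) bE (leqnn _)
    ltac:(rewrite /m; lia) ltac:(rewrite /m; lia).
  have := nshort a b ((e a * e b) ^ q) (e b ^ q) ab1; have := lene _ _ ab1.
  have eqQ Q (Qcl : nielsen_closed Q) : Q ((e a * e b) ^ q) (e b ^ q) <-> Q (e a) (e b).
    by rewrite (nielsen_conjE Qcl) (nielsen_mulE Qcl).
  move=> le /(_ eqQ); rewrite leqNgt => /negP; apply.
  by rewrite -le addnC [X in (_ < X)%N]addnC; apply: lq.
have is_letter i : exists a, gen i = e a.
  have [w rw gE] := generates_reduced_prod (gen i) guv.
  have := size_reduced_prod e_gt0 e_cancel e_overlap rw; rewrite -gE.
  case: w {rw} gE => [|a [|b w]] //; first by rewrite big_nil => /(congr1 (@word 2)).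
  by rewrite big_seq1; exists a.
have [a aE] := is_letter ord0; have [b bE] := is_letter ord_max.
apply/(@pair_eltE _ u v P Pcl a b); last by rewrite -/e -aE -bE.
by apply/eqP => /letter2_eq [] ab; move: aE; rewrite ab ?eV -bE => /(congr1 (@word 2)).
Qed.

End NielsenReduction.

(** * Homomorphisms from the free group to the integers *)

Section IntegerCharacters.
Variables (n : nat) (c : 'I_n -> int).
Local Notation F := (free_group n).
Local Open Scope ring_scope.
Implicit Types g h : F.

Definition letter_weight (a : letter n) : int := if a.2 then - c a.1 else c a.1.

Definition weight g : int := \sum_(a <- word g) letter_weight a.

Lemma weight_reduce w :
  \sum_(a <- reduce w) letter_weight a = \sum_(a <- w) letter_weight a.
Proof.
elim: w => //= a w IH; rewrite big_cons -IH /push.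
case: (reduce w) => [|b t]; first by rewrite big_seq1 big_nil addr0.
case: eqP => [->|_]; rewrite !big_cons // /letter_weight.
by case: a => i [] /=; rewrite ?addNKr ?addKr // addrA ?subrr ?addNr add0r.
Qed.

Lemma weightM g h : weight (g * h)%g = weight g + weight h.
Proof. by rewrite /weight weight_reduce big_cat. Qed.

Lemma weight1 : weight 1%g = 0.
Proof. by rewrite /weight big_nil. Qed.

Lemma weightV g : weight g^-1%g = - weight g.
Proof. by apply/eqP; rewrite -subr_eq0 opprK -weightM mulVg weight1. Qed.

Lemma weightJ g h : weight (g ^ h)%g = weight g.
Proof. by rewrite /conjg !weightM weightV addrCA addNr addr0. Qed.

Lemma weight_letter a : weight (letter_elt a) = letter_weight a.
Proof. by rewrite letter_elt_word /weight weight_reduce big_seq1. Qed.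

Lemma weight_derived g : derived_subgroup F g -> weight g = 0.
Proof.
move=> dg; apply: (dg [set k | weight k = 0]); split; first split=> [|x y|x] /=.
- exact: weight1.
- by rewrite weightM => -> ->.
- by rewrite weightV => ->.
move=> _ [x _ [y _ <-]] /=.
by rewrite /commg weightM weightV weightJ addNr.
Qed.

Lemma weight_abmap g h : abmap g = abmap h -> weight g = weight h.
Proof.
move/abmapP/weight_derived; rewrite weightM weightV => /eqP.
by rewrite addrC subr_eq0 => /eqP.
Qed.

End IntegerCharacters.

(** * Positive bases and Nielsen's theorem *)

Section PositiveBases.
Local Notation F := (free_group 2).
Implicit Types (g h u v U V : F) (a b : letter 2).

(** The pairs of positive words in the letters a and b that are reached from
    (a, b) by positive moves.  The second move multiplies on the left, which
    makes the two rules exchange roles when the entries are swapped. *)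
Inductive positive_pair a b : F -> F -> Prop :=
| PositiveBase : positive_pair a b (letter_elt a) (letter_elt b)
| PositiveLeft U V : positive_pair a b U V -> positive_pair a b (U * V) V
| PositiveRight U V : positive_pair a b U V -> positive_pair a b U (V * U).

Definition sign_eq u U := u = U \/ u = U^-1.

Definition positive_up_to_conj u v : Prop := exists g a b U V,
  [/\ a.1 != b.1, positive_pair a b U V, sign_eq (u ^ g) U & sign_eq (v ^ g) V].

Lemma positive_pairC a b U V : positive_pair a b U V -> positive_pair b a V U.
Proof. by elim=> *; [apply: PositiveBase|apply: PositiveRight|apply: PositiveLeft]. Qed.

Lemma sign_eqV u U : sign_eq u U -> sign_eq u^-1 U.
Proof. by case=> ->; [right|left; rewrite invgK]. Qed.

(** Division undoes the last move if that move was (u, v) |-> (u v, v), becomes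
    a positive move for the letters a and b^-1 if there was none, and after the
    other move produces a conjugate of another positive pair. *)
Lemma positive_pair_div a b U V : a.1 != b.1 -> positive_pair a b U V ->
  positive_up_to_conj (U * V^-1) V.
Proof.
move=> ab; case=> [|{}U {}V pUV|{}U {}V pUV].
- exists 1, a, (letter_inv b), (letter_elt a * letter_elt (letter_inv b)),
    (letter_elt (letter_inv b)).
  rewrite !conjg1 letter_elt_inv; split=> //.
  + rewrite -letter_elt_inv; apply: PositiveLeft; exact: PositiveBase.
  + by left.
  + by right; rewrite invgK.
- by exists 1, a, b, U, V; rewrite !conjg1 mulgK; split=> //; left.
- (* The pair (V^-1, V U) is conjugate by V to (V^-1, U V). *)
  exists V, b, a, V, (U * V); split; first by rewrite eq_sym.
  + exact/PositiveRight/positive_pairC.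
  + by right; rewrite invgM mulVKg conjVg /conjg mulKg.
  + by left; rewrite /conjg -mulgA mulKg.
Qed.

Lemma positive_up_to_conj_closed : nielsen_closed positive_up_to_conj.
Proof.
have conjP g u v : positive_up_to_conj u v -> positive_up_to_conj (u ^ g) (v ^ g).
  move=> [h [a [b [U [V [ab pUV uU vV]]]]]]; exists (g^-1 * h), a, b, U, V.
  by rewrite -!conjgM mulVKg.
have invP u v : positive_up_to_conj u v -> positive_up_to_conj u^-1 v.
  move=> [h [a [b [U [V [ab pUV uU vV]]]]]]; exists h, a, b, U, V.
  by split=> //; rewrite conjVg; apply: sign_eqV.
have swapP u v : positive_up_to_conj u v -> positive_up_to_conj v u.
  move=> [h [a [b [U [V [ab pUV uU vV]]]]]]; exists h, b, a, V, U.
  by split=> //; [rewrite eq_sym|apply: positive_pairC].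
split=> // u v [g [a [b [U [V [ab pUV uU vV]]]]]].
suff : positive_up_to_conj ((u * v) ^ g) (v ^ g) by move/(conjP g^-1); rewrite !conjgK.
rewrite conjMg; move: (u ^ g) (v ^ g) uU vV => {u v g} u v uU vV.
have idiv := positive_pair_div ab pUV.
case: uU vV => -> [] ->.
- by exists 1, a, b, (U * V), V; rewrite !conjg1; split=> //; [apply: PositiveLeft|left|left].
- exact/swapP/invP/swapP.
- (* Inverted and conjugated, this is the division case. *)
  have -> : U^-1 * V = (U * V^-1)^-1 ^ V by rewrite invgM invgK /conjg mulgA mulKg.
  by rewrite -[V in positive_up_to_conj _ V](mulKg V V); apply/conjP/invP.
- (* U^-1 V^-1 is the inverse of V U, which V conjugates to U V. *)
  exists V, a, b, (U * V), V; split=> //; first exact: PositiveLeft.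
  + by right; rewrite /conjg mulgVK invgM.
  + by right; rewrite conjVg /conjg mulKg.
Qed.

Lemma positive_pair_weight a b U V (c : 'I_2 -> int) :
  letter_weight c a = 1%R -> letter_weight c b = 1%R -> positive_pair a b U V ->
  (1 <= weight c U /\ 1 <= weight c V)%R.
Proof.
move=> ca cb; elim=> [|{}U {}V _ [cU cV]|{}U {}V _ [cU cV]];
  rewrite ?weightM ?weight_letter; lia.
Qed.

Lemma gens_generate : generates (gen ord0 : F) (gen ord_max).
Proof.
move=> A [A1 AM AV] A0 A_max g; rewrite -[g]wordE.
elim: (word g) => [|a w IH]; first by rewrite big_nil.
rewrite big_cons; apply: AM => //.
have Agen i : A (gen i).
  by case: (eqVneq i ord0) => [->//|i0]; rewrite (@ord2_neq i ord0 ord_max).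
by rewrite /letter_elt; case: ifP => _ //; apply: AV.
Qed.

Lemma aut_generates (s : aut F) : generates (s (gen ord0)) (s (gen ord_max)).
Proof.
move=> A [A1 AM AV] A0 A_max g.
have [f sK fK] := aut_bij s; rewrite -(fK g).
apply: (gens_generate (A := [set k | A (s k)])) => //.
by split=> [|x y|x] /=; rewrite ?aut1 ?autM ?autV //; [apply: AM|apply: AV].
Qed.

Lemma aut_ext_gens (s t : aut F) : (forall i, s (gen i) = t (gen i)) -> s = t.
Proof.
move=> st; apply/aut_eqP => g.
apply: (gens_generate (A := [set k | s k = t k])) => //=.
by split=> [|x y|x] /=; rewrite ?aut1 ?autM ?autV // => -> // ->.
Qed.

Lemma letter_weight_inj (i : 'I_2) (a : letter 2) :
  (forall c, letter_weight c a = c i) -> a = (i, false).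
Proof.
move/(_ (fun j => (j == i)%:R)%R); rewrite /letter_weight eqxx.
by case: a => j [] /=; case: eqVneq => //= ->.
Qed.

(** Nielsen's theorem.  The pair (s x_1, s x_2) generates, hence is positive up
    to conjugation and signs for some letters a and b.  Weighting the generators
    by the signs of a and b makes both letters weigh 1, so a positive move would
    yield an entry of weight at least 2; but s preserves weights, so the entries
    weigh as much as a generator or its inverse. *)
Theorem IA2_inner (s : aut F) : IA s -> exists g, s = inner g.
Proof.
move=> IAs.
have sW c g : weight c (s g) = weight c g.
  apply: weight_abmap; rewrite -ab_aut_funE.
  by have /(congr1 (fun t : aut _ => t (abmap g))) := IAs.
have base : positive_up_to_conj (gen ord0) (gen ord_max).
  exists 1, (ord0, false), (ord_max, false), (gen ord0), (gen ord_max).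
  by rewrite !conjg1; split=> //; [apply: PositiveBase|left|left].
have [g [a [b [U [V [ab pUV uU vV]]]]]] :=
  nielsen_induction positive_up_to_conj_closed base (@aut_generates s).
pose sg (d : letter 2) : int := if d.2 then (-1)%R else 1%R.
(* As a and b have distinct indices, c is a choice of sign on each generator. *)
pose c i := if i == a.1 then sg a else sg b.
have ca : letter_weight c a = 1%R by rewrite /letter_weight /c eqxx /sg; case: (a.2).
have cb : letter_weight c b = 1%R.
  by rewrite /letter_weight /c eq_sym (negbTE ab) /sg; case: (b.2).
have le1 u (i : 'I_2) W : u = s (gen i) -> sign_eq (u ^ g) W -> (weight c W <= 1)%R.
  move=> -> sW'; have : weight c (s (gen i) ^ g) = c i.
    by rewrite weightJ sW -[gen i]/(letter_elt (i, false)) weight_letter.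
  have : (c i = 1 \/ c i = -1)%R.
    by rewrite /c /sg; case: ifP => _; case: ifP => _; [right|left|right|left].
  by case: sW' => ->; rewrite ?weightV; lia.
have [leU leV] := (le1 _ ord0 _ erefl uU, le1 _ ord_max _ erefl vV).
have isgen (i : 'I_2) d : sign_eq (s (gen i) ^ g) (letter_elt d) -> s (gen i) ^ g = gen i.
  move=> sd; have [d' dE] : exists d', s (gen i) ^ g = letter_elt d'.
    by case: sd => ->; [exists d|exists (letter_inv d); rewrite letter_elt_inv].
  rewrite dE (_ : d' = (i, false)) //; apply: letter_weight_inj => c'.
  rewrite -weight_letter -dE weightJ sW -[gen i]/(letter_elt (i, false)).
  by rewrite weight_letter.
exists g^-1; apply: aut_ext_gens => i /=; apply: (canRL (conjgK g)).
case: pUV leU leV uU vV => [_ _ uU vV|{}U {}V pUV leU _ _ _|{}U {}V pUV _ leV _ _].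
- case: (eqVneq i ord0) => [->|i0]; first exact: isgen uU.
  by rewrite (@ord2_neq i ord0 ord_max) //; apply: isgen vV.
- by have := positive_pair_weight ca cb pUV; rewrite weightM in leU; lia.
- by have := positive_pair_weight ca cb pUV; rewrite weightM in leV; lia.
Qed.

End PositiveBases.

(** * Group rings *)

Section GroupRingLemmas.
Variable G : groupType.
Local Open Scope ring_scope.
Implicit Types (g h : G) (u v : 'Z[G]).

Lemma malgU_int g (a : int) : << a *g g >> = gr_elt g *~ a :> 'Z[G].
Proof. by rewrite -[in LHS](intz a) (raddfMz (mkmalgU g)). Qed.

Lemma gr_eltM g h : gr_elt (g * h)%g = gr_elt g * gr_elt h.
Proof. by rewrite [RHS]gr_mulUU mulr1. Qed.

Lemma gr_additive_ext (V : zmodType) (f1 f2 : 'Z[G] -> V) :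
  {morph f1 : u v / u + v} -> {morph f2 : u v / u + v} ->
  (forall g, f1 (gr_elt g) = f2 (gr_elt g)) -> f1 =1 f2.
Proof.
move=> f1D f2D f12 u.
have f10 : f1 0 = 0 by apply: (addrI (f1 0)); rewrite -f1D !addr0.
have f20 : f2 0 = 0 by apply: (addrI (f2 0)); rewrite -f2D !addr0.
pose F1 : {additive 'Z[G] -> V} := HB.pack f1
  (GRing.isNmodMorphism.Build 'Z[G] V f1 (f10, f1D)).
pose F2 : {additive 'Z[G] -> V} := HB.pack f2
  (GRing.isNmodMorphism.Build 'Z[G] V f2 (f20, f2D)).
elim/gr_ind: u => [|u v IHu IHv|a g]; first by rewrite f10 f20.
  by rewrite f1D f2D IHu IHv.
by rewrite malgU_int [LHS](raddfMz F1) [RHS](raddfMz F2) /= f12.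
Qed.

Lemma gr_elt_inj : injective (@gr_elt G).
Proof.
move=> g h /malgP/(_ h)/eqP; rewrite mcoeffUU mcoeffU.
by case: (eqVneq g h).
Qed.

Lemma mcoeff_gr_eltM g h u : (gr_elt g * u : 'Z[G])@_(g * h)%g = u@_h.
Proof.
elim/gr_ind: u => [|u v IHu IHv|a k]; first by rewrite mulr0 !mcoeff0.
  by rewrite mulrDr !mcoeffD IHu IHv.
by rewrite [X in X@__ = _]gr_mulUU mul1r !mcoeffU (inj_eq (mulgI g)).
Qed.

(** A nonzero u with g u = u would have a finite nonempty support stable under
    translation by g, which is impossible at a point where phi is maximal. *)
Lemma gr_elt_sub1_reg (phi : G -> int) g u :
  (forall h, phi (g * h)%g = phi h + 1) -> (gr_elt g - 1) * u = 0 -> u = 0.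
Proof.
move=> phiS gu; have {}gu : gr_elt g * u = u.
  by apply/eqP; rewrite -subr_eq0 -[X in _ - X]mul1r -mulrBl gu.
have sub h : h \in msupp u -> (g * h)%g \in msupp u.
  by rewrite -!mcoeff_neq0 -[in X in _ -> X]gu mcoeff_gr_eltM.
apply/malgP => h0; rewrite mcoeff0; apply/eqP; rewrite mcoeff_eq0.
apply/negP => h0u.
have maxP (s : seq G) : s != [::] ->
    exists2 h, h \in s & forall k, k \in s -> (phi k <= phi h)%R.
  elim: s => // h [|k s] IH _.
    by exists h; rewrite ?mem_head // => k; rewrite inE => /eqP ->.
  have [m ms mP] := IH isT; have [le|lt] := lerP (phi m) (phi h).
    exists h; rewrite ?mem_head // => l; rewrite inE => /predU1P[->//|/mP lm].
    exact: le_trans lm le.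
  exists m; first by rewrite inE ms orbT.
  by move=> l; rewrite inE => /predU1P[->|/mP //]; apply: ltW.
have [|h hu hmax] := maxP (enum_fset (msupp u)).
  by have : h0 \in enum_fset (msupp u) := h0u; case: (enum_fset _).
have := hmax (g * h)%g (sub h hu); rewrite phiS; lia.
Qed.

End GroupRingLemmas.

(** * Fox derivatives along a representation in a ring *)

Section FoxDerivative.
Variables (n : nat) (R : nzRingType) (e : free_group n -> R).
Local Notation F := (free_group n).
Local Open Scope ring_scope.
Hypotheses (e1 : e 1%g = 1) (eM : forall g h, e (g * h)%g = e g * e h).
Implicit Types (g h : F) (i j : 'I_n) (a : letter n) (w : seq (letter n)).

(** The value of the Fox derivative of a letter under the ring homomorphism
    that extends e.  Over an arbitrary ring R the rules below are formal; they
    are used for R = Z[H]. *)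
Definition dletter j a : R :=
  e (if a.2 then (gen a.1)^-1 else 1)%g *~ ((-1) ^+ a.2 * (a.1 == j)%:R).

Fixpoint dword j w : R :=
  if w is a :: w' then dletter j a + e (letter_elt a) * dword j w' else 0.

Definition dfox j g : R := dword j (word g).

Lemma dword_reduce j w : dword j (reduce w) = dword j w.
Proof.
elim: w => //= a w IH; rewrite -IH /push.
case: (reduce w) => [|b t] //=.
case: eqP => [->|_] //=.
rewrite mulrDr addrA mulrA -eM letter_elt_inv mulgV e1 mul1r.
rewrite -[LHS]add0r; congr (_ + _).
case: a => i [] /=; rewrite /dletter /letter_elt /= mulrzAr -eM.
  by rewrite mulg1 mul1r mulN1r mulrNz addNr.
by rewrite mulgV mul1r mulN1r mulrNz e1 subrr.
Qed.

Lemma dword_cat j w t :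
  dword j (w ++ t) = dword j w + e (of_word w) * dword j t.
Proof.
elim: w => [|a w IH] /=.
  by rewrite add0r (_ : of_word [::] = 1%g) ?e1 ?mul1r //; apply/val_inj.
rewrite IH -[a :: w]cat1s of_word_cat -letter_elt_word.
by rewrite eM mulrDr addrA mulrA.
Qed.

Lemma dfoxM j g h : dfox j (g * h)%g = dfox j g + e g * dfox j h.
Proof. by rewrite /dfox dword_reduce dword_cat of_wordK. Qed.

Lemma dfox_gen i j : dfox j (gen i) = (i == j)%:R.
Proof.
rewrite /dfox /= mulr0 addr0 /dletter /= e1 mul1r.
by case: (i == j); rewrite ?mulr1z ?mulr0z.
Qed.

Lemma dfoxV j g : e g * dfox j g^-1%g = - dfox j g.
Proof. by apply/eqP; rewrite -addr_eq0 addrC -dfoxM mulgV. Qed.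

(** Both sides are obtained by expanding the derivative of
    g (g^-1 x_i g) = x_i g in two ways. *)
Lemma dfoxJ i j g : e g * dfox j (gen i ^ g)%g =
  (i == j)%:R + (e (gen i) - 1) * dfox j g.
Proof.
have := dfoxM j g (gen i ^ g)%g; rewrite -conjgC dfoxM dfox_gen => E.
by rewrite mulrBl mul1r addrA E addrC addKr.
Qed.

End FoxDerivative.

Section AbelianizedFox.
Variable n : nat.
Local Notation F := (free_group n).
Local Notation H := (abelianization F).
Local Open Scope ring_scope.
Implicit Types (g h : F) (i j : 'I_n).

Definition ab_elt g : 'Z[H] := gr_elt (abmap g).

Lemma ab_elt1 : ab_elt 1%g = 1. Proof. by []. Qed.

Lemma ab_eltM g h : ab_elt (g * h)%g = ab_elt g * ab_elt h.
Proof. by rewrite /ab_elt abmapM; apply: gr_eltM. Qed.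

Lemma ab_ring_elt g : ab_ring (gr_elt g) = ab_elt g.
Proof. exact: gr_lift_elt. Qed.

Lemma ab_ringMz (u : 'Z[F]) (k : int) : ab_ring (u *~ k) = ab_ring u *~ k.
Proof. exact: raddfMz. Qed.

Lemma ab_ring_eltM g (u : 'Z[F]) :
  ab_ring (gr_elt g * u) = ab_elt g * ab_ring u.
Proof.
apply: (gr_additive_ext (f1 := fun u => ab_ring (gr_elt g * u))
                        (f2 := fun u => ab_elt g * ab_ring u)).
- by move=> x y /=; rewrite mulrDr [LHS]gr_liftD.
- by move=> x y /=; rewrite [ab_ring _]gr_liftD mulrDr.
- by move=> h; rewrite -gr_eltM !ab_ring_elt; apply: ab_eltM.
Qed.

Lemma fox_word_cons j a w : fox_word j (a :: w) =
  dletter (@gr_elt F) j a + gr_elt (letter_elt a) * fox_word j w.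
Proof.
rewrite /fox_word /= big_ord_recl /= (tnth_nth a) /= big_nil mul1g.
congr (_ + _); rewrite mulr_sumr; apply: eq_bigr => k _.
by rewrite !(tnth_nth a) /= big_cons -!mulgA gr_eltM mulrzAr.
Qed.

Lemma ab_foxE j g : ab_ring (fox j (gr_elt g)) = dfox ab_elt j g.
Proof.
rewrite /fox gr_lift_elt /dfox; elim: (word g) => [|a w IH] /=.
  by rewrite /fox_word big_ord0; apply: gr_lift0.
rewrite fox_word_cons [LHS]gr_liftD; congr (_ + _).
  by rewrite /dletter [LHS]ab_ringMz ab_ring_elt.
by rewrite -IH; apply: ab_ring_eltM.
Qed.

End AbelianizedFox.

(** * The derived group modulo the second derived group *)

Section DerivedGroup.
Variable G : groupType.
Implicit Types g h : G.

Lemma derivedP : is_subgroup (derived_subgroup G).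
Proof. exact: comm_subgroupP. Qed.

Lemma second_derivedP : is_subgroup (second_derived_subgroup G).
Proof. exact: comm_subgroupP. Qed.

Lemma second_derived_commg g h :
  derived_subgroup G g -> derived_subgroup G h -> second_derived_subgroup G [~ g, h].
Proof. by move=> dg dh; apply: sub_gen_smallest; exists g => //; exists h. Qed.

Lemma second_derived_ind (A : set G) : is_subgroup A ->
  (forall g h, derived_subgroup G g -> derived_subgroup G h -> A [~ g, h]) ->
  forall g, second_derived_subgroup G g -> A g.
Proof. by move=> sA AR g; apply; split=> // _ [x dx [y dy <-]]; apply: AR. Qed.

Lemma second_derived_sub g :
  second_derived_subgroup G g -> derived_subgroup G g.
Proof.
by apply: (second_derived_ind derivedP) => x y _ _; apply: derived_commg.
Qed.

Lemma second_derivedJ g h :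
  second_derived_subgroup G g -> second_derived_subgroup G (g ^ h).
Proof.
have [s1 sM sV] := second_derivedP.
apply: (second_derived_ind (A := [set x | second_derived_subgroup G (x ^ h)])).
  split=> [|x y sx sy|x sx] /=; rewrite ?conj1g ?conjMg ?conjVg //.
    exact: (sM _ _ sx sy).
  exact: (sV _ sx).
by move=> x y dx dy /=; rewrite conjRg; apply: second_derived_commg; apply: derived_conjg.
Qed.

Definition in_derived : pred G := fun g => `[< derived_subgroup G g >].

Lemma in_derivedP g : reflect (derived_subgroup G g) (g \in in_derived).
Proof. exact: asboolP. Qed.

Lemma in_derived_closed : group_closed in_derived.
Proof.
have [d1 dM dV] := derivedP; split; first exact/in_derivedP.
move=> x y /in_derivedP dx /in_derivedP dy; apply/in_derivedP.
by apply: (dM _ _ dx); apply: (dV _ dy).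
Qed.

Record derived_group := DerivedGroup { dval : G; dvalP : dval \in in_derived }.
HB.instance Definition _ := [isSub for dval].
HB.instance Definition _ := [Choice of derived_group by <:].
HB.instance Definition _ :=
  SubChoice_isSubGroup.Build G in_derived derived_group in_derived_closed.

(** The quotient of the derived group by the second one, as an additive group:
    the maps gr_lift defined on a group ring take values in such groups. *)
Definition derived_ab : Type := abelianization derived_group.
HB.instance Definition _ := Choice.on derived_ab.

Let A := abelianization derived_group.
Fact derived_ab_addA : associative (fun x y : derived_ab => (x : A) * (y : A) : derived_ab).
Proof. by move=> x y z; apply: mulgA. Qed.
Fact derived_ab_addC : commutative (fun x y : derived_ab => (x : A) * (y : A) : derived_ab).
Proof. by move=> x y; apply: abelianization_mulC. Qed.
Fact derived_ab_add0 :
  left_id (1 : A) (fun x y : derived_ab => (x : A) * (y : A) : derived_ab).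
Proof. by move=> x; apply: mul1g. Qed.
Fact derived_ab_addN : left_inverse (1 : A) (fun x : derived_ab => (x : A)^-1 : derived_ab)
  (fun x y : derived_ab => (x : A) * (y : A) : derived_ab).
Proof. by move=> x; apply: mulVg. Qed.
HB.instance Definition _ := GRing.isZmodule.Build derived_ab
  derived_ab_addA derived_ab_addC derived_ab_add0 derived_ab_addN.

(** Meaningful on the derived group; other elements are sent to 0. *)
Definition derived_class g : derived_ab :=
  abmap (insubd (1 : derived_group) g).

Lemma derived_classM g h : derived_subgroup G g -> derived_subgroup G h ->
  derived_class (g * h) = (derived_class g + derived_class h)%R.
Proof.
move=> dg dh; have [_ dM _] := derivedP.
rewrite /derived_class; transitivity
  (abmap (insubd (1 : derived_group) g * insubd (1 : derived_group) h)); last exact: abmapM.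
congr abmap; apply/val_inj; rewrite valM !val_insubd.
by rewrite !ifT //; apply/in_derivedP => //; apply: (dM _ _ dg dh).
Qed.

Lemma derived_class1 : derived_class 1 = 0%R.
Proof.
rewrite /derived_class (_ : insubd _ _ = 1) //; apply/val_inj.
by rewrite val_insubd val1; case: ifP.
Qed.

Lemma derived_class_eq0 g : derived_subgroup G g -> derived_class g = 0%R ->
  second_derived_subgroup G g.
Proof.
move=> dg /esym/abmapP; rewrite invg1 mul1g => dd.
have [s1 sM sV] := second_derivedP.
suff : second_derived_subgroup G (val (insubd (1 : derived_group) g)).
  by rewrite val_insubd ifT //; apply/in_derivedP.
apply: (dd [set x | second_derived_subgroup G (val x)]); split.
  split=> [|x y sx sy|x sx] /=; rewrite ?val1 ?valM ?gmulfV //.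
    exact: (sM _ _ sx sy).
  exact: (sV _ sx).
move=> _ [x _ [y _ <-]].
have vR : val [~ x, y] = [~ val x, val y] by rewrite /commg /conjg !valM !gmulfV.
rewrite /mkset vR; apply: second_derived_commg; apply/in_derivedP; exact: valP.
Qed.

End DerivedGroup.

Lemma abmapV (G : groupType) (g : G) : abmap g^-1 = (abmap g)^-1.
Proof. exact/esym/abmap_inv. Qed.

Section MagnusEmbedding.
Variable n : nat.
Local Notation F := (free_group n).
Local Notation H := (abelianization F).
Local Notation V := (derived_ab F).
Local Open Scope ring_scope.
Implicit Types (g k : F) (h : H) (j : 'I_n).

(** The path labelled g that starts at h in the Cayley graph of H, closed up by
    the chosen representatives of its end points.  For a generator g these are
    the Schreier generators of the derived group. *)
Definition schreier h g : F := (repr h * g * (repr (h * abmap g))^-1)%g.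

Lemma schreier_derived h g : derived_subgroup F (schreier h g).
Proof.
have [_ _ dV] := derivedP F.
rewrite -[schreier h g]mul1g -invg1; apply/abmapP.
by rewrite /schreier !abmapM abmapV !abmap_repr mulgV.
Qed.

Lemma schreierM h g k :
  schreier h (g * k)%g = (schreier h g * schreier (h * abmap g)%g k)%g.
Proof. by rewrite /schreier abmapM !mulgA mulgVK. Qed.

Section EdgeSum.
Variables (R : nzRingType) (E : H -> R) (L : 'I_n -> {additive R -> V}).
Hypothesis EM : forall h h1 : H, E (h * h1)%g = E h * E h1.
Hypothesis LE : forall j h, L j (E h) = derived_class (schreier h (gen j)).

(** The product of the Schreier elements along the path labelled w telescopes,
    and modulo the second derived group it can be rearranged so as to count each
    edge with the multiplicity recorded by the Fox derivatives.  A letter x_i^-1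
    traverses backwards the edge that starts at h x_i^-1, in accordance with its
    derivative - x_i^-1. *)
Lemma edge_sum_fox h w :
  \sum_j L j (E h * dword (E \o @abmap F) j w) =
  derived_class (schreier h (of_word w)).
Proof.
elim: w h => [|a w IH] h /=.
  rewrite big1 => [|j _]; last by rewrite mulr0 raddf0.
  rewrite (_ : of_word _ = 1%g) ?/schreier; last exact: val_inj.
  by rewrite mulg1 [(h * _)%g]mulg1 mulgV derived_class1.
rewrite -[a :: w]cat1s of_word_cat -letter_elt_word schreierM.
rewrite derived_classM; try exact: schreier_derived.
rewrite -IH -(eq_bigr _ (fun j _ => esym (congr1 (L j) (mulrDr _ _ _)))).
under eq_bigr do rewrite mulrA -EM raddfD.
rewrite big_split; congr (_ + _) => /=.
have LEz j k (z : int) : L j (E h * (E (abmap k) *~ z)) =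
    derived_class (schreier (h * abmap k)%g (gen j)) *~ z.
  by rewrite mulrzAr -EM raddfMz /= LE.
rewrite (bigD1 a.1) //= big1 => [|j ja]; last first.
  by rewrite LEz eq_sym (negbTE ja) mulr0 mulr0z.
rewrite LEz eqxx addr0; case: a => i [] /=.
  rewrite mulr1 mulrN1z; apply/eqP; rewrite eq_sym -addr_eq0; apply/eqP.
  rewrite -derived_classM; try exact: schreier_derived.
  rewrite -schreierM mulVg /schreier.
  by rewrite mulg1 [(h * _)%g]mulg1 mulgV derived_class1.
by rewrite [(h * _)%g]mulg1 mulr1.
Qed.

End EdgeSum.

(** The path labelled g that starts at 1 is closed, so its Schreier element is
    a conjugate of g; by edge_sum_fox its class is the sum over no edges. *)
Lemma fox_eq0_second_derived g : derived_subgroup F g ->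
  (forall j, dfox (@ab_elt n) j g = 0) -> second_derived_subgroup F g.
Proof.
move=> dg Dg; have g1 : abmap g = 1%g.
  by apply/esym/abmapP; rewrite invg1 mul1g.
rewrite -(conjgK (repr (1%g : H))^-1%g g); apply: second_derivedJ.
have -> : (g ^ (repr (1%g : H))^-1)%g = schreier 1%g g.
  by rewrite /schreier g1 mulg1 /conjg invgK mulgA.
apply: derived_class_eq0; first exact: schreier_derived.
pose L j : {additive 'Z[H] -> V} :=
  gr_lift (fun h => derived_class (schreier h (gen j))).
rewrite -[g in LHS]of_wordK -(@edge_sum_fox 'Z[H] (@gr_elt H) L).
- by apply: big1 => j _; rewrite [dword _ _ _]Dg mulr0; apply: gr_lift0.
- exact: gr_eltM.
- by move=> j h; apply: gr_lift_elt.
Qed.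

(** On the derived group the factor e g in the product rule is 1, so the Fox
    derivatives are additive there and vanish on commutators. *)
Lemma second_derived_fox_eq0 g j : second_derived_subgroup F g ->
  dfox (@ab_elt n) j g = 0.
Proof.
have e1 := @ab_elt1 n; have eM := @ab_eltM n; have [d1 dM dV] := derivedP F.
have ed k : derived_subgroup F k -> ab_elt k = 1.
  move=> dk; rewrite /ab_elt (_ : abmap k = 1%g) //.
  by apply/esym/abmapP; rewrite invg1 mul1g.
have D1 : dfox (@ab_elt n) j 1%g = 0 by [].
have DM k l : derived_subgroup F k ->
    dfox (@ab_elt n) j (k * l)%g = dfox (@ab_elt n) j k + dfox (@ab_elt n) j l.
  by move=> dk; rewrite dfoxM // ed // mul1r.
have DV k : derived_subgroup F k -> dfox (@ab_elt n) j k^-1%g = - dfox (@ab_elt n) j k.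
  by move=> dk; rewrite -(dfoxV e1 eM) ed // mul1r.
move=> sg; suff [] : (derived_subgroup F g /\ dfox (@ab_elt n) j g = 0) by [].
apply: (second_derived_ind
  (A := [set k | derived_subgroup F k /\ dfox (@ab_elt n) j k = 0])) sg.
  split=> [|x y [dx Dx] [dy Dy]|x [dx Dx]] //=.
    by split; [apply: (dM _ _ dx dy)|rewrite DM // Dx Dy addr0].
  by split; [apply: (dV _ dx)|rewrite DV // Dx oppr0].
move=> x y dx dy /=; split; first exact: derived_commg.
have [dx' dy'] := (dV _ dx, dV _ dy).
rewrite /commg /conjg !(DM, DV) //; try exact: dM.
by rewrite [X in _ + (_ + X)]addrC addKr addNr.
Qed.

End MagnusEmbedding.

(** * The kernel of the Magnus representation *)

Section MagnusInner.
Variable n : nat.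
Local Notation F := (free_group n).
Local Notation H := (abelianization F).
Local Open Scope ring_scope.
Implicit Types (g : F) (i j : 'I_n).

(** The exponent sum in x_i factors through H. *)
Lemma ab_elt_gen_sub1_reg i (u : 'Z[H]) : (ab_elt (gen i) - 1) * u = 0 -> u = 0.
Proof.
pose phi (h : H) := weight (fun j => (j == i)%:R) (repr h).
apply: (gr_elt_sub1_reg (phi := phi)); elim/ab_ind => g.
have phiE k : phi (abmap k) = weight (fun j => (j == i)%:R) k.
  by apply: weight_abmap; rewrite abmap_repr.
rewrite -abmapM !phiE weightM addrC -[gen i]/(letter_elt (i, false)) weight_letter.
by rewrite /letter_weight eqxx.
Qed.

Lemma magnus_innerE g i j :
  ab_elt g * magnus (inner g) i j = (i == j)%:R + (ab_elt (gen i) - 1) * dfox (@ab_elt n) j g.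
Proof. by rewrite mxE ab_foxE; apply: dfoxJ; [exact: ab_elt1|exact: ab_eltM]. Qed.

Lemma ab_elt_eq1 g : ab_elt g = 1 <-> derived_subgroup F g.
Proof.
split=> [/gr_elt_inj/esym/abmapP|dg]; first by rewrite invg1 mul1g.
by congr gr_elt; apply/esym/abmapP; rewrite invg1 mul1g.
Qed.

Lemma inner_IA g : IA (inner g).
Proof.
apply/aut_eqP; elim/ab_ind => x /=; rewrite ab_aut_funE /= /conjg !abmapM.
by rewrite abmapV abelianization_mulC mulgK.
Qed.

End MagnusInner.

(** In rank at least 2 each j has an index i different from it, for which
    magnus_innerE reads (x_i - 1) D_j g = 0 when the matrix is the identity.  In
    rank 1 the matrix is always the identity, but F'' is trivial. *)
Lemma magnus_inner_eq1 (n : nat) (g : free_group n.+2) :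
  magnus (inner g) = 1%:M%R <-> second_derived_subgroup (free_group n.+2) g.
Proof.
split=> [Mg|sg].
  have Mij i j : (ab_elt g * (i == j)%:R =
      (i == j)%:R + (ab_elt (gen i) - 1) * dfox (@ab_elt n.+2) j g)%R.
    by rewrite -magnus_innerE Mg mxE.
  have Dg j : dfox (@ab_elt n.+2) j g = 0%R.
    apply: (ab_elt_gen_sub1_reg (i := lift j ord0)).
    have := Mij (lift j ord0) j.
    by rewrite eq_sym (negbTE (neq_lift _ _)) mulr0 add0r.
  apply: fox_eq0_second_derived => //; apply/ab_elt_eq1.
  by have := Mij ord0 ord0; rewrite eqxx Dg mulr0 addr0 mulr1.
have g1 : ab_elt g = 1%R by apply/ab_elt_eq1; exact: (second_derived_sub sg).
apply/matrixP => i j.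
transitivity (ab_elt g * magnus (inner g) i j)%R; first by rewrite g1 mul1r.
by rewrite magnus_innerE second_derived_fox_eq0 // mulr0 addr0 mxE.
Qed.

Theorem proposition1 :
  magnus_kernel 2 = [set inner g | g in second_derived_subgroup (free_group 2)].
Proof.
apply/seteqP; split=> [s [/IA2_inner[g ->] Mg]|_ [g sg <-]].
  by exists g => //; apply/magnus_inner_eq1.
by split; [exact: inner_IA|exact/magnus_inner_eq1].
Qed.
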